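(* For any two integers $p,q$ with $1<p$ and $q\geq 2p$, there exists a graph $G$ such that $\tau_3(G)=p$ and $\tau_3(L(G))=q$, where $L(G)$ is the line graph of $G$.
   Context: All graphs are finite, simple and undirected. For a graph $G$ and $S\subseteq V(G)$ with $|S|\geq 2$, an $S$-Steiner tree is a subgraph of $G$ that is a tree whose vertex set contains $S$; it is a pendant $S$-Steiner tree if every vertex of $S$ has degree exactly $1$ in the tree. Two pendant $S$-Steiner trees $T,T'$ are internally disjoint if $E(T)\cap E(T')=\varnothing$ and $V(T)\cap V(T')=S$. $\tau_G(S)$ is the maximum number of pairwise internally disjoint pendant $S$-Steiner trees in $G$. For an integer $k$ with $2\leq k\leq |V(G)|$, $\tau_k(G)=\min\{\tau_G(S): S\subseteq V(G),|S|=k\}$. *)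

(* Defs.v *)
From mathcomp Require Import all_boot.

Set Implicit Arguments.
Unset Strict Implicit.
Unset Printing Implicit Defensive.

Record sgraph := SGraph {
  vertex :> finType;
  adj : rel vertex;
  adj_sym : symmetric adj;
  adj_irrefl : irreflexive adj
}.

Definition edges (G : sgraph) : {set {set G}} :=
  [set e : {set G} | [exists x, exists y, adj x y && (e == [set x; y])]].

Definition line_vertex (G : sgraph) : finType :=
  {e : {set G} | e \in edges G}.

Definition line_adj (G : sgraph) : rel (line_vertex G) :=
  fun e f => (e != f) && (val e :&: val f != set0).

Lemma line_adj_sym (G : sgraph) : symmetric (@line_adj G).
Proof. by move=> e f; rewrite /line_adj eq_sym setIC. Qed.

Lemma line_adj_irrefl (G : sgraph) : irreflexive (@line_adj G).
Proof. by move=> e; rewrite /line_adj eqxx. Qed.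

Definition line_graph (G : sgraph) : sgraph :=
  SGraph (@line_adj_sym G) (@line_adj_irrefl G).

Section Steiner.
Variable G : sgraph.

(* A candidate subgraph is a pair (vertex set, edge set); it is an actual
   subgraph of G when is_subgraph holds. *)
Definition subgraph : finType := ({set G} * {set {set G}})%type.

Definition is_subgraph (H : subgraph) : bool :=
  (H.2 \subset edges G) && [forall e in H.2, e \subset H.1].

Definition sub_adj (H : subgraph) : rel G := fun x y => [set x; y] \in H.2.

Definition degree (H : subgraph) (x : G) : nat := #|[set e in H.2 | x \in e]|.

Definition connected (H : subgraph) : bool :=
  (H.1 != set0) &&
  [forall x in H.1, forall y in H.1, connect (sub_adj H) x y].

(* The vertices of a cycle are distinct, so only lengths up to #|G| matter;
   see acyclicP. *)
Definition acyclic (H : subgraph) : bool :=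
  [forall n : 'I_#|G|.+1, forall c : n.-tuple G,
    ucycleb (sub_adj H) c ==> (n < 3)].

Lemma acyclicP (H : subgraph) :
  reflect (forall c : seq G, ucycle (sub_adj H) c -> size c < 3) (acyclic H).
Proof.
apply: (iffP forallP) => [acH c cyc_c | acH n].
  have c_le : size c < #|G|.+1.
    by case/andP: cyc_c => _ /card_uniqP <-; rewrite ltnS max_card.
  by have /forallP/(_ (in_tuple c))/implyP := acH (Ordinal c_le); apply.
by apply/forallP => c; apply/implyP => /acH; rewrite size_tuple.
Qed.

Definition is_tree (H : subgraph) : bool :=
  [&& is_subgraph H, connected H & acyclic H].

Definition steiner_tree (S : {set G}) (H : subgraph) : bool :=
  is_tree H && (S \subset H.1).

Definition pendant_steiner_tree (S : {set G}) (H : subgraph) : bool :=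
  steiner_tree S H && [forall x in S, degree H x == 1].

Definition internally_disjoint (S : {set G}) (H H' : subgraph) : bool :=
  (H.2 :&: H'.2 == set0) && (H.1 :&: H'.1 == S).

Definition steiner_packing (S : {set G}) (P : {set subgraph}) : bool :=
  [forall H in P, pendant_steiner_tree S H] &&
  [forall H in P, forall H' in P, (H != H') ==> internally_disjoint S H H'].

Definition tau_set (S : {set G}) : nat :=
  \max_(P : {set subgraph} | steiner_packing S P) #|P|.

(* The neutral element #|subgraph| bounds every tau_set S, so for k <= #|G|
   this is the true minimum (tau_attained, tau_min).  For k > #|G| there is no
   k-set and the value #|subgraph| is meaningless. *)
Definition tau (k : nat) : nat :=
  \big[minn/#|subgraph|]_(S : {set G} | #|S| == k) tau_set S.

Lemma tau_min (k : nat) (S : {set G}) : #|S| = k -> tau k <= tau_set S.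
Proof.
move/eqP=> Sk; rewrite /tau; have := mem_index_enum S.
elim: (index_enum _) => //= S' r IHr; rewrite inE big_cons.
case/predU1P => [<-|/IHr le_r]; first by rewrite Sk geq_minl.
by case: ifP => // _; rewrite geq_min le_r orbT.
Qed.

Lemma tau_set_le (S : {set G}) : tau_set S <= #|subgraph|.
Proof. by apply/bigmax_leqP => P _; apply: max_card. Qed.

Lemma tau_attained (k : nat) :
  k <= #|G| -> exists2 S : {set G}, #|S| = k & tau k = tau_set S.
Proof.
move=> k_le.
pose S0 := [set x in take k (enum G)].
have S0k : #|S0| == k.
  rewrite cardsE; have /card_uniqP -> := take_uniq k (enum_uniq G).
  by rewrite size_takel // -cardE.
case: (@arg_minnP _ S0 (fun S : {set G} => #|S| == k) tau_set S0k).
move=> S /eqP Sk minS; exists S => //; apply/eqP.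
rewrite eqn_leq tau_min //=; rewrite /tau.
by elim/big_ind: _ => [|m n Sm Sn|//]; rewrite ?tau_set_le // leq_min Sm Sn.
Qed.

End Steiner.

(* Main.v *)
Require Import Defs.
From mathcomp Require Import all_boot zify.

(* The witness is the complete bipartite graph K_{n,m} with n = p + 2 and
   m = q - p + 2, so that n <= m, and p = n - 2, q = n + m - 4. Its line graph is
   the n x m rook graph. For |S| = 3, a pendant S-Steiner tree is a connected
   subgraph avoiding S with every vertex of S hung on as a leaf, so tau(S) is
   the maximum number of disjoint connected sets outside S that are adjacent
   to every vertex of S; in particular tau(S) <= |N(s) \ S| for s in S. Two
   vertices of the n-side and one of the m-side, respectively three cells
   forming an L, make this bound equal to n - 2, respectively n + m - 4. The
   lower bounds use vertices and edges of K_{n,m}, and pieces of rows and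
   columns of the rook graph. *)

Set Implicit Arguments.
Unset Strict Implicit.
Unset Printing Implicit Defensive.

Lemma eq_set2 (T : finType) (x y u v : T) :
  [set x; y] = [set u; v] -> x = u /\ y = v \/ x = v /\ y = u.
Proof.
move=> exy; have /set2P xuv : x \in [set u; v] by rewrite -exy set21.
have /set2P yuv : y \in [set u; v] by rewrite -exy set22.
have /set2P uxy : u \in [set x; y] by rewrite exy set21.
have /set2P vxy : v \in [set x; y] by rewrite exy set22.
by intuition congruence.
Qed.

(** * Trees as subgraphs, grown by attaching leaves *)

Section PendantTrees.
Variable G : sgraph.
Implicit Types (H : subgraph G) (S : {set G}).

Lemma edgesP (e : {set G}) :
  reflect (exists x y, adj x y /\ e = [set x; y]) (e \in edges G).
Proof.
rewrite inE; apply: (iffP existsP).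
  by case=> x /existsP[y /andP[xy /eqP Ee]]; exists x, y.
by case=> x [y [xy ->]]; exists x; apply/existsP; exists y; rewrite xy eqxx.
Qed.

Lemma mem_edges (x y : G) : ([set x; y] \in edges G) = adj x y.
Proof.
apply/edgesP/idP => [[u [v [uv /eq_set2 exy]]]|xy]; last by exists x, y.
by case: exy => -[-> ->] //; rewrite adj_sym.
Qed.

Lemma sub_adj_sym H : symmetric (sub_adj H).
Proof. by move=> x y; rewrite /sub_adj setUC. Qed.

Lemma subgraph_edge_sub H e : is_subgraph H -> e \in H.2 -> e \subset H.1.
Proof. by case/andP=> _ /forall_inP sH /sH. Qed.

Lemma subgraph_mem H x y : is_subgraph H -> sub_adj H x y -> x \in H.1.
Proof. by move=> sgH /(subgraph_edge_sub sgH)/subsetP; apply; apply: set21. Qed.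

Lemma subgraph_adj H x y : is_subgraph H -> sub_adj H x y -> adj x y.
Proof. by case/andP=> /subsetP sH _ /sH; rewrite mem_edges. Qed.

Definition attach H (x y : G) : subgraph G :=
  (y |: H.1, [set x; y] |: H.2).

Lemma sub_adj_attach H x y u v :
  sub_adj (attach H x y) u v ->
  [\/ sub_adj H u v, u = x /\ v = y | u = y /\ v = x].
Proof.
by case/setU1P=> [/eq_set2[]|uv]; [constructor 2|constructor 3|constructor 1].
Qed.

(** A cycle avoiding [y] already lies in [H], and a cycle through [y] would need two distinct
    neighbours of [y], which has only [x]. *)
Lemma is_tree_attach H x y :
  is_tree H -> x \in H.1 -> y \notin H.1 -> adj x y -> is_tree (attach H x y).
Proof.
case/and3P=> sgH cH /acyclicP aH xH yH xy.
have xDy : x != y by apply: contraTneq xy => ->; rewrite adj_irrefl.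
apply/and3P; split.
- case/andP: sgH => sE /forall_inP sV; apply/andP; split.
    by rewrite subUset sub1set mem_edges xy.
  apply/forall_inP=> e /setU1P[->|/sV eH].
    by rewrite subUset !sub1set /= !inE xH eqxx orbT.
  exact: subset_trans eH (subsetUr _ _).
- case/andP: cH => _ /forall_inP cH; apply/andP; split.
    by apply/set0Pn; exists y; rewrite setU11.
  have cs := sym_connect_sym (@sub_adj_sym (attach H x y)).
  have cx u : u \in (attach H x y).1 -> connect (sub_adj (attach H x y)) x u.
    case/setU1P=> [->|uH].
      by apply: connect1; rewrite /sub_adj setU11.
    have /forall_inP/(_ _ uH) := cH _ xH; apply: connect_sub => a b ab.
    by apply: connect1; apply/setU1P; right.
  apply/forall_inP=> u uH; apply/forall_inP=> v vH.
  by apply: connect_trans (cx v vH); rewrite cs cx.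
- apply/acyclicP=> c cc.
  have [yc|yc] := boolP (y \in c); last first.
    apply: aH; case/andP: cc => cc uc; apply/andP; split=> //.
    apply: (@sub_in_cycle _ (mem c)) cc => [u v uc' vc|]; last exact/allP.
    case/sub_adj_attach=> [//|[_ ev]|[eu _]].
      by rewrite -ev vc in yc.
    by rewrite -eu uc' in yc.
  (* Both neighbours of [y] on the cycle must be [x]. *)
  case: (rot_to yc) => i s Ec.
  move: cc; rewrite -(rot_ucycle i) -(size_rot i) Ec => /andP[].
  have nbr_y u : sub_adj (attach H x y) y u -> u = x.
    case/sub_adj_attach=> [/(subgraph_mem sgH)|[yx _]|[]] //.
      by rewrite (negPf yH).
    by rewrite yx eqxx in xDy.
  case: s {Ec} => [|a s] //= /andP[/nbr_y->]; rewrite rcons_path => /andP[_].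
  rewrite sub_adj_sym => /nbr_y ls /and3P[_ xs _].
  case/lastP: s ls xs => [//|s z]; rewrite last_rcons mem_rcons inE => ->.
  by rewrite eqxx.
Qed.

(** Steps that stay in place are allowed, so that one uniform list of vertices remains a walk when
    some of its entries coincide. *)
Definition eq_adj : rel G := fun x y => (x == y) || adj x y.

(** Follow the walk: a new vertex is attached as a leaf to its predecessor, and a repeated one
    leaves the tree unchanged. *)
Lemma tree_of_walk x p :
  path eq_adj x p -> exists2 H, is_tree H & H.1 = [set z in x :: p].
Proof.
elim/last_ind: p => [_|p y IHp].
  exists ([set x], set0); last by apply/setP=> z; rewrite !inE.
  apply/and3P; split.
  - by rewrite /is_subgraph sub0set; apply/forall_inP=> e; rewrite inE.
  - apply/andP; split; first by apply/set0Pn; exists x; rewrite set11.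
    by apply/forall_inP=> u /set1P->; apply/forall_inP=> v /set1P->.
  - apply/acyclicP=> -[//|a [|b s]] /andP[] //=.
    by rewrite /sub_adj inE.
rewrite rcons_path => /andP[/IHp[H tH EH] ly].
have lH : last x p \in H.1 by rewrite EH inE mem_last.
have [yH|yH] := boolP (y \in H.1).
  exists H => //; apply/setP=> z; rewrite EH !inE mem_rcons inE.
  by case: (z =P y) => [->|//]; move: yH; rewrite EH !inE => ->; rewrite orbT.
exists (attach H (last x p) y); last first.
  by apply/setP=> z; rewrite /= EH !inE mem_rcons inE orbCA.
apply: is_tree_attach => //; case/predU1P: ly => // ly.
by rewrite -ly lH in yH.
Qed.

(** * Pendant Steiner trees and bounds on [tau_set] *)

(** The vertices of [S] are hung on [H] one at a time. That no edge lies inside [S] is recorded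
    because it makes trees that meet only in [S] edge-disjoint. *)
Lemma pendant_extension S H :
  is_tree H -> {in S, forall s, s \notin H.1} ->
  {in S, forall s, exists2 x, x \in H.1 & adj x s} ->
  exists T : subgraph G, [/\ pendant_steiner_tree S T, T.1 = H.1 :|: S &
    {in T.2, forall e : {set G}, ~~ (e \subset S)}].
Proof.
move=> tH dHS nHS.
(* For the induction, the leaves run through a list, while the edge condition keeps the whole of
   [S]. *)
suff [T [tT ET dT eT]] : exists T : subgraph G, [/\ is_tree T,
    T.1 = H.1 :|: [set z in enum S], {in enum S, forall z, degree T z = 1} &
    {in T.2, forall e : {set G}, ~~ (e \subset S)}].
  have ES : [set z in enum S] = S by apply/setP=> z; rewrite inE mem_enum.
  rewrite ES in ET; exists T; split=> //.
  rewrite /pendant_steiner_tree /steiner_tree tT ET subsetUr /=.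
  by apply/forall_inP=> z zS; rewrite dT // mem_enum.
have : {subset enum S <= S} by move=> z; rewrite mem_enum.
elim: (enum S) (enum_uniq S) => [_ _|z s IHs /= /andP[zs us] sS].
  exists H; split=> //.
    by apply/setP=> z; rewrite !inE orbF.
  case/and3P: tH => sgH _ _ e eH; apply/negP=> /subsetP eS.
  have /edgesP[x [y [_ Ee]]] : e \in edges G.
    by case/andP: sgH => /subsetP/(_ _ eH).
  have xe : x \in e by rewrite Ee set21.
  have := subsetP (subgraph_edge_sub sgH eH) _ xe.
  by rewrite (negPf (dHS _ (eS _ xe))).
have [|T [tT ET dT eT]] := IHs us.
  by move=> w ws; apply: sS; rewrite inE ws orbT.
have zS : z \in S by apply: sS; rewrite mem_head.
have [x xH xz] := nHS z zS.
have xT : x \in T.1 by rewrite ET inE xH.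
have zT : z \notin T.1 by rewrite ET !inE negb_or zs dHS.
have sgT : is_subgraph T by case/and3P: tT.
exists (attach T x z); split.
- exact: is_tree_attach.
- by apply/setP=> w; rewrite /= ET !inE orbCA.
- move=> w; rewrite inE => /predU1P[->|ws].
    rewrite /degree; apply/eqP/cards1P; exists [set x; z]; apply/setP=> e.
    rewrite !inE; case: eqP => [->|_] /=; first by rewrite set22.
    apply/negP=> /andP[/(subgraph_edge_sub sgT)/subsetP sub /sub].
    by rewrite (negPf zT).
  rewrite -(dT w ws) /degree; congr #|pred_of_set _|.
  apply/setP=> e; rewrite !inE; case: eqP => [->|//] /=.
  have wS : w \in S by apply: sS; rewrite inE ws orbT.
  have -> : w \in [set x; z] = false.
    apply/negP=> /set2P[wx|wz]; last by rewrite -wz ws in zs.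
    by have := dHS w wS; rewrite wx xH.
  by rewrite andbF.
- move=> e /setU1P[->|/eT//].
  rewrite subUset !sub1set negb_and; apply/orP; left.
  by apply: contraL xH => /dHS.
Qed.

(* The trees of a packing meet only in [S], so each contains a private
   neighbour of [s]; it lies outside [S] because two leaves of a tree on more
   than two vertices are not adjacent. *)
Lemma tau_set_le_neighbours S s :
  2 < #|S| -> s \in S -> tau_set S <= #|[set y | adj s y] :\: S|.
Proof.
move=> S2 sS; apply/bigmax_leqP=> P /andP[/forall_inP pP /forall_inP dP].
have nbr H : H \in P -> exists y, (y \notin S) && sub_adj H s y.
  move=> /pP /andP[/andP[/and3P[sgH /andP[_ /forall_inP cH] _] /subsetP SH]].
  move/forall_inP=> dH.
  have leaf z e f :
      z \in S -> e \in H.2 -> f \in H.2 -> z \in e -> z \in f -> e = f.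
    move=> /dH /cards1P[g Eg] eH fH ze zf.
    have : e \in [set g] by rewrite -Eg inE eH.
    have : f \in [set g] by rewrite -Eg inE fH.
    by move=> /set1P-> /set1P->.
  have /cards1P[e Ee] := dH s sS.
  have : e \in [set e in H.2 | s \in e] by rewrite Ee set11.
  rewrite inE => /andP[eH se].
  have [y Ey] : exists y, e = [set s; y].
    case/andP: sgH => /subsetP/(_ _ eH)/edgesP[u [v [_ Euv]]] _.
    by move: se; rewrite Euv => /set2P[->|->]; [exists v | exists u; rewrite setUC].
  exists y; rewrite /sub_adj -Ey eH andbT; apply/negP=> yS.
  (* If [y] were in [S], then [e] would be the only edge of [H] at both of its ends, hence a whole
     component, and a third vertex [t] of [S] could not be reached. *)
  have [t tS te] : exists2 t, t \in S & t \notin e.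
    apply/subsetPn; apply/negP=> /subset_leq_card.
    by rewrite leqNgt (leq_ltn_trans _ S2) // Ey cards2; case: (_ != _).
  have clE : closed (sub_adj H) (mem e).
    apply: (intro_closed (sym_connect_sym (@sub_adj_sym H))) => u v uv ue.
    have uS : u \in S by move: (ue : u \in e); rewrite Ey => /set2P[->|->].
    suff: v \in e by [].
    rewrite (leaf u e _ uS eH uv ue (set21 _ _)); exact: set22.
  have /forall_inP/(_ _ (SH _ tS)) := cH _ (SH _ sS).
  by move/(closed_connect clE); rewrite /= se (negPf te).
(* The default [s] is never taken for [H] in [P], by [nbr]. *)
pose f H := odflt s [pick y | (y \notin S) && sub_adj H s y].
have fP H : H \in P -> (f H \notin S) && sub_adj H s (f H).
  by move/nbr=> [y yH]; rewrite /f; case: pickP => [z //|/(_ y)]; rewrite yH.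
have fH1 H : H \in P -> f H \in H.1.
  move=> HP; case/andP: (fP H HP) => _; rewrite sub_adj_sym.
  by apply: subgraph_mem; case/pP/andP: HP => /andP[/and3P[]].
rewrite -(card_in_imset (f := f) (D := mem P)).
  apply/subset_leq_card/subsetP=> _ /imsetP[H HP ->].
  case/andP: (fP H HP) => fS sf; rewrite !inE fS.
  by apply: subgraph_adj sf; case/pP/andP: HP => /andP[/and3P[]].
move=> H H' HP HP' Ef; apply/eqP/negPn/negP=> nH.
have /forall_inP/(_ _ HP')/implyP/(_ nH)/andP[_ /eqP E] := dP H HP.
have : f H \in H.1 :&: H'.1 by rewrite inE fH1 // Ef fH1.
by rewrite E; apply/negP; case/andP: (fP H HP).
Qed.

(** The common form of all lower bounds: each walk is turned into a tree, on which [S] is then hung.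
    As [S] is nonempty, the adjacency condition forces the walks to be nonempty, so disjoint walks
    give distinct trees. *)
Lemma tau_set_ge_walks (I : finType) (A : {set I}) (F : I -> seq G) S :
    S != set0 ->
    (forall i, i \in A -> sorted eq_adj (F i)) ->
    (forall i x, i \in A -> x \in F i -> x \notin S) ->
    (forall i s, i \in A -> s \in S -> has (fun x => adj x s) (F i)) ->
    (forall i j x, i \in A -> j \in A -> x \in F i -> x \in F j -> i = j) ->
  #|A| <= tau_set S.
Proof.
case/set0Pn=> s0 s0S wF dF nF FF.
have /fin_all_exists[T TP] i : exists T : subgraph G, i \in A ->
    [/\ pendant_steiner_tree S T, T.1 = [set z in F i] :|: S &
    {in T.2, forall e : {set G}, ~~ (e \subset S)}].
  have [iA|] := boolP (i \in A); last by exists (set0, set0).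
  have := wF i iA; have := nF i s0 iA s0S.
  have := nF i ^~ iA; have := dF i ^~ iA.
  case: (F i) => // x p dx nx _ /tree_of_walk[H tH EH].
  have [||T [pT ET eT]] := pendant_extension tH (S := S).
  - by move=> s sS; rewrite EH inE; apply: contraL sS => /dx.
  - by move=> s /nx /hasP[y yx ys]; exists y; rewrite // EH inE.
  by exists T; rewrite -EH.
have TI i j : i \in A -> j \in A -> i != j -> (T i).1 :&: (T j).1 = S.
  move=> iA jA ij; have [_ -> _] := TP i iA; have [_ -> _] := TP j jA.
  rewrite -setUIl; apply/setUidPr/subsetP=> x; rewrite !inE => /andP[xi xj].
  by rewrite (FF i j x iA jA xi xj) eqxx in ij.
have Tinj : {in A &, injective T}.
  move=> i j iA jA ET; apply/eqP/negPn/negP=> ij.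
  have := TI i j iA jA ij; rewrite -ET setIid; have [_ -> _] := TP i iA.
  have /hasP[x xi _] := nF i s0 iA s0S.
  move/setP/(_ x); rewrite !inE xi /= => /esym xS.
  by have := dF i x iA xi; rewrite xS.
rewrite -(card_in_imset Tinj); apply: (@leq_bigmax_cond _ _ (fun P : {set subgraph G} => #|P|)).
apply/andP; split.
  by apply/forall_inP=> _ /imsetP[i /TP[pT _ _] ->].
apply/forall_inP=> _ /imsetP[i iA ->]; apply/forall_inP=> _ /imsetP[j jA ->].
apply/implyP=> nT; have {nT} ij : i != j by apply: contraNneq nT => ->.
rewrite /internally_disjoint TI // eqxx andbT.
(* A common edge would have both ends in the common vertex set [S]. *)
apply/eqP/setP=> e; rewrite [RHS]inE; apply/negP=> /setIP[ei ej].
have [/andP[/andP[/and3P[sgi _ _] _] _] _ /(_ e ei)/negP] := TP i iA; apply.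
have [/andP[/andP[/and3P[sgj _ _] _] _] _ _] := TP j jA.
by rewrite -(TI i j) // subsetI !subgraph_edge_sub.
Qed.

End PendantTrees.

Lemma card_set3 (T : finType) (a b c : T) :
  #|[set a; b; c]| = (c \notin [set a; b]) + (a != b).+1.
Proof. by rewrite setUC cardsU1 cards2. Qed.

Lemma cards3_exists (T : finType) (S : {set T}) :
  #|S| = 3 -> exists x y z, S = [set x; y; z].
Proof.
move=> S3; have /set0Pn[x xS] : S != set0 by rewrite -card_gt0 S3.
have : #|S :\ x| == 2 by move: S3; rewrite (cardsD1 x) xS add1n => -[->].
by case/cards2P=> y [z [_ E]]; exists x, y, z; rewrite -setUA -E setD1K.
Qed.

Definition sum_set (I J : finType) (X : {set I}) (Y : {set J}) : {set I + J} :=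
  [set u | match u with inl i => i \in X | inr j => j \in Y end].

Lemma card_sum_set (I J : finType) (X : {set I}) (Y : {set J}) :
  #|sum_set X Y| = #|X| + #|Y|.
Proof.
rewrite -!sum1_card big_sumType /=.
by congr (_ + _); apply: eq_bigl => i; rewrite inE.
Qed.

(** * Packings in rook graphs *)

Section Rook.
(** The board is given by an abstract map [cell], so that rows and columns can be exchanged by
    transposing it. *)
Variables (G : sgraph) (n m : nat) (cell : 'I_n -> 'I_m -> G).
Hypothesis cell_eq :
  forall i j i' j', (cell i j == cell i' j') = (i == i') && (j == j').
Hypothesis cell_adj : forall i j i' j',
  adj (cell i j) (cell i' j') =
    ~~ ((i == i') && (j == j')) && ((i == i') || (j == j')).

(** Any two cells of one line are equal or adjacent, so every list of them is a walk. Row pieces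
    stay out of the columns in [Y], hence never meet column pieces. *)
Lemma tau_set_ge_lines (S : {set G}) (X : {set 'I_n}) (Y : {set 'I_m})
    (f : 'I_n -> seq 'I_m) (g : 'I_m -> seq 'I_n) :
    S != set0 ->
    (forall i j, i \in X -> j \in f i -> (cell i j \notin S) && (j \notin Y)) ->
    (forall i j, j \in Y -> i \in g j -> cell i j \notin S) ->
    (forall i s, i \in X -> s \in S -> has (fun j => adj (cell i j) s) (f i)) ->
    (forall j s, j \in Y -> s \in S -> has (fun i => adj (cell i j) s) (g j)) ->
  #|X| + #|Y| <= tau_set S.
Proof.
move=> S0 fS gS fN gN; rewrite -card_sum_set.
pose F (u : 'I_n + 'I_m) := match u with
  | inl i => [seq cell i j | j <- f i] | inr j => [seq cell i j | i <- g j] end.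
apply: (tau_set_ge_walks (F := F)) => //.
- move=> [i|j] _ /=; rewrite sorted_map.
    case: (f i) => //= a s; elim: s a => //= b s IHs a; rewrite IHs.
    by rewrite /eq_adj cell_eq cell_adj eqxx; case: (a == b).
  case: (g j) => //= a s; elim: s a => //= b s IHs a; rewrite IHs.
  by rewrite /eq_adj cell_eq cell_adj eqxx; case: (a == b).
- move=> [i|j] x; rewrite inE => uA /mapP[k ku ->].
    by case/andP: (fS i k uA ku).
  exact: gS.
- by move=> [i|j] s; rewrite inE has_map => uA sS; [apply: fN|apply: gN].
- move=> [i|j] [i'|j'] x; rewrite !inE => uA vA /mapP[k ku ->] /mapP[l lv] /eqP;
    rewrite cell_eq => /andP[/eqP e1 /eqP e2]; subst => //.
  + by case/andP: (fS _ _ uA ku) => _; rewrite vA.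
  + by case/andP: (fS _ _ vA lv) => _; rewrite uA.
Qed.

Variables (r1 r2 r3 : 'I_n) (c1 c2 c3 : 'I_m).
Let S := [set cell r1 c1; cell r2 c2; cell r3 c3].

Let S_neq0 : S != set0.
Proof. by apply/set0Pn; exists (cell r1 c1); rewrite !inE eqxx. Qed.

(* In each row other than that of the first cell, take the cells in the columns
   [c1], [c2], [c3], except a second or third cell of [S] itself; they avoid [S]
   because the columns are distinct. *)
Lemma tau_set_rook_distinct : c1 != c2 -> c1 != c3 -> c2 != c3 ->
  n + m - 4 <= tau_set S.
Proof.
move=> /negPf c12 /negPf c13 /negPf c23.
(* Replacing a column by [c1] only repeats the first cell, which sees the omitted cell of [S] along
   the row. *)
pose f r := [:: c1; if r == r2 then c1 else c2; if r == r3 then c1 else c3].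
(* The n - 1 rows are joined by the m - 3 columns free of [S], each taking its cells in the rows of
   [S]. *)
have := @tau_set_ge_lines S [set~ r1] (~: [set c1; c2; c3]) f
  (fun=> [:: r1; r2; r3]) S_neq0.
rewrite !cardsC1 [#|~: [set _; _; _]|]cardsCs setCK !card_ord card_set3.
rewrite !inE ![c3 == _]eq_sym c12 c13 c23 /=.
move=> H; apply: leq_trans (H _ _ _ _) => {H}.
- by have := ltn_ord r1; have := ltn_ord c1; lia.
- move=> i j; rewrite !inE !cell_eq => /negPf ir; rewrite ir.
  have [c21 c31 c32] : [/\ c2 == c1 = false, c3 == c1 = false & c3 == c2 = false].
    by split; rewrite eq_sym.
  move=> jf.
  have {jf} : [|| j == c1, (i != r2) && (j == c2) | (i != r3) && (j == c3)].
    by move: jf; case: (i == r2); case: (i == r3); case: (j == c1).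
  by case/or3P=> [|/andP[/negPf->]|/andP[/negPf->]] /eqP->;
    rewrite ?eqxx ?c12 ?c13 ?c23 ?c21 ?c31 ?c32 ?andbF ?orbT.
- move=> i j; rewrite !inE !cell_eq !negb_or.
  move=> /andP[/andP[/negPf-> /negPf->] /negPf->].
  by rewrite !andbF.
- move=> i s; rewrite !inE /= => /negPf ir /orP[/orP[]|] /eqP->;
    rewrite !cell_adj ?ir ?eqxx ?andbT ?orbT //=.
    by case: (i =P r2) => [->|_]; rewrite ?eqxx ?orbT ?c12 //= orbT.
  by case: (i =P r3) => [->|_]; rewrite ?eqxx ?orbT ?c13 //= !orbT.
- move=> j s; rewrite !inE !negb_or /=.
  move=> /andP[/andP[/negPf j1 /negPf j2] /negPf j3].
  by case/orP=> [/orP[]|] /eqP->; rewrite !cell_adj ?j1 ?j2 ?j3 eqxx ?andbF ?orbT.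
Qed.

(** At least n - 2 rows and m - 2 columns miss [S]. Such a row takes its cells in the columns of
    [S], and such a column its cells in the rows of [S]. *)
Lemma tau_set_rook_few :
  #|[set r1; r2; r3]| <= 2 -> #|[set c1; c2; c3]| <= 2 ->
  n + m - 4 <= tau_set S.
Proof.
move=> R2 C2.
have := @tau_set_ge_lines S (~: [set r1; r2; r3]) (~: [set c1; c2; c3])
  (fun=> [:: c1; c2; c3]) (fun=> [:: r1; r2; r3]) S_neq0.
move=> H; apply: leq_trans (H _ _ _ _) => {H}.
- rewrite (cardsCs (~: [set r1; _; _])) (cardsCs (~: [set c1; _; _])).
  rewrite !setCK !card_ord.
  by have := ltn_ord r1; have := ltn_ord c1; lia.
- move=> i j; rewrite !inE !cell_eq !negb_or.
  move=> /andP[/andP[/negPf-> /negPf->] /negPf->] /=.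
  by case/or3P=> /eqP->; rewrite eqxx ?andbF ?orbT.
- move=> i j; rewrite !inE !cell_eq !negb_or.
  move=> /andP[/andP[/negPf-> /negPf->] /negPf->] _ /=.
  by rewrite !andbF.
- move=> i s; rewrite !inE !negb_or /=.
  move=> /andP[/andP[/negPf i1 /negPf i2] /negPf i3].
  by case/orP=> [/orP[]|] /eqP->; rewrite !cell_adj ?i1 ?i2 ?i3 eqxx ?andbF ?orbT.
- move=> j s; rewrite !inE !negb_or /=.
  move=> /andP[/andP[/negPf j1 /negPf j2] /negPf j3].
  by case/orP=> [/orP[]|] /eqP->; rewrite !cell_adj ?j1 ?j2 ?j3 eqxx ?andbF ?orbT.
Qed.
End Rook.

(** Either the three columns are distinct, or the three rows are, or there is a repetition among
    both. *)
Lemma tau_set_ge_rook (G : sgraph) (n m : nat) (cell : 'I_n -> 'I_m -> G)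
    (r1 r2 r3 : 'I_n) (c1 c2 c3 : 'I_m) :
    (forall i j i' j', (cell i j == cell i' j') = (i == i') && (j == j')) ->
    (forall i j i' j', adj (cell i j) (cell i' j') =
       ~~ ((i == i') && (j == j')) && ((i == i') || (j == j'))) ->
  n + m - 4 <= tau_set [set cell r1 c1; cell r2 c2; cell r3 c3].
Proof.
move=> cellE adjE.
have few (T : finType) (a b c : T) :
    [|| a == b, a == c | b == c] -> #|[set a; b; c]| <= 2.
  rewrite card_set3 !inE ![c == _]eq_sym.
  by do 2!case: eqP => //= _; case: eqP.
have [Ec|] := boolP [|| c1 == c2, c1 == c3 | c2 == c3]; last first.
  by rewrite !negb_or => /and3P[*]; apply: tau_set_rook_distinct.
have [Er|] := boolP [|| r1 == r2, r1 == r3 | r2 == r3]; last first.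
  rewrite !negb_or addnC => /and3P[*].
  (* Distinct rows are distinct columns of the transposed board. *)
  apply: (@tau_set_rook_distinct G m n (fun j i => cell i j)) => // *.
    by rewrite cellE andbC.
  by rewrite adjE andbC orbC [_ && (_ == _)]andbC andbC.
by apply: tau_set_rook_few => //; apply: few.
Qed.

(** * The complete bipartite graph *)

Section CompleteBipartite.
Variables n m : nat.

Definition biclique_adj : rel ('I_n + 'I_m) := fun x y =>
  match x, y with inl _, inr _ | inr _, inl _ => true | _, _ => false end.

Lemma biclique_adj_sym : symmetric biclique_adj.
Proof. by case=> i [] j. Qed.

Lemma biclique_adj_irrefl : irreflexive biclique_adj.
Proof. by case. Qed.

Definition biclique : sgraph := SGraph biclique_adj_sym biclique_adj_irrefl.

(** If [S] lies in one side, every single vertex of the other side serves. Otherwise each side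
    contains at most two vertices of [S], and pairing n - 2 free vertices of both sides gives
    disjoint edges that see all of [S]. *)
Lemma tau_set_ge_biclique (S : {set biclique}) :
  1 < n -> n <= m -> #|S| = 3 -> n - 2 <= tau_set S.
Proof.
move=> n1 nm S3.
have S0 : S != set0 by rewrite -card_gt0 S3.
pose SA := [set i | (inl i : biclique) \in S].
pose SB := [set j | (inr j : biclique) \in S].
have S3' : #|SA| + #|SB| = 3.
  rewrite -card_sum_set -S3; congr #|pred_of_set _|.
  by apply/setP=> -[i|j]; rewrite !inE.
have [SA0|[i0 Si0]] := set_0Vmem SA.
  have nS i : (inl i : biclique) \notin S.
    by have := in_set0 i; rewrite -SA0 inE => ->.
  apply: leq_trans (leq_subr 2 n) _.
  rewrite -[X in X <= _]card_ord -cardsT.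
  apply: (@tau_set_ge_walks biclique _ _ (fun i => [:: inl i])) => //.
  - by move=> i x _; rewrite inE => /eqP->.
  - by move=> i [s|s] //= _ sS; move: (nS s); rewrite sS.
  - by move=> i j x _ _; rewrite !inE => /eqP-> /eqP[].
have [SB0|[j0 Sj0]] := set_0Vmem SB.
  have nS i : (inr i : biclique) \notin S.
    by have := in_set0 i; rewrite -SB0 inE => ->.
  apply: leq_trans (leq_subr 2 n) _; apply: leq_trans nm _.
  rewrite -[X in X <= _]card_ord -cardsT.
  apply: (@tau_set_ge_walks biclique _ _ (fun i => [:: inr i])) => //.
  - by move=> i x _; rewrite inE => /eqP->.
  - by move=> i [s|s] //= _ sS; move: (nS s); rewrite sS.
  - by move=> i j x _ _; rewrite !inE => /eqP-> /eqP[].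
have SA1 : 0 < #|SA| by apply/card_gt0P; exists i0.
have SB1 : 0 < #|SB| by apply/card_gt0P; exists j0.
have lA : n - 2 <= #|~: SA| by rewrite cardsCs setCK card_ord; lia.
have lB : n - 2 <= #|~: SB| by rewrite cardsCs setCK card_ord; lia.
pose a k : 'I_n := enum_val (widen_ord lA k).
pose b k : 'I_m := enum_val (widen_ord lB k).
have aS k : (inl (a k) : biclique) \notin S.
  by have := enum_valP (widen_ord lA k); rewrite !inE.
have bS k : (inr (b k) : biclique) \notin S.
  by have := enum_valP (widen_ord lB k); rewrite !inE.
rewrite -[X in X <= _]card_ord -cardsT.
apply: (@tau_set_ge_walks biclique _ _ (fun k => [:: inl (a k); inr (b k)])) => //.
- by move=> k x _; rewrite !inE => /orP[]/eqP->.
- by move=> k [s|s].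
- move=> k l x _ _; rewrite !inE => /orP[]/eqP-> /orP[]/eqP // [];
    move=> /enum_val_inj/(congr1 val) /=; exact: val_inj.
Qed.

Lemma tau_biclique : 1 < n -> n <= m -> tau biclique 3 = n - 2.
Proof.
move=> n1 nm; apply/eqP; rewrite eqn_leq; apply/andP; split; last first.
  have [|S S3 ->] := @tau_attained biclique 3.
    by rewrite card_sum !card_ord; lia.
  exact: tau_set_ge_biclique.
have n0 : 0 < n by lia.
have m0 : 0 < m by lia.
(* Of the n neighbours of [y], two lie in the chosen set. *)
pose x : biclique := inl (Ordinal n0).
pose x' : biclique := inl (Ordinal n1).
pose y : biclique := inr (Ordinal m0).
have S3 : #|[set x; x'; y]| = 3 by rewrite card_set3 !inE.
apply: leq_trans (tau_min S3) _.
have yS : y \in [set x; x'; y] by rewrite !inE eqxx !orbT.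
apply: leq_trans (tau_set_le_neighbours _ yS) _; first by rewrite S3.
have <- : #|~: [set Ordinal n0; Ordinal n1]| = n - 2.
  by rewrite cardsCs setCK card_ord cards2.
rewrite -(card_imset _ (@inl_inj 'I_n 'I_m)).
apply/subset_leq_card/subsetP=> -[i|j]; rewrite !inE ?andbF // => /andP[xS _].
apply: imset_f; rewrite !inE; apply: contra xS.
by case/orP=> /eqP->; rewrite eqxx ?orbT.
Qed.

(** * Its line graph as a rook graph *)

Lemma cell_subproof (i : 'I_n) (j : 'I_m) :
  [set (inl i : biclique); inr j] \in edges biclique.
Proof. by rewrite mem_edges. Qed.

Definition cell (i : 'I_n) (j : 'I_m) : line_graph biclique :=
  exist (fun e => e \in edges biclique) _ (cell_subproof i j).

Lemma cell_surj (e : line_graph biclique) : exists i j, e = cell i j.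
Proof.
have /edgesP[u [v [uv Ee]]] := valP e.
case: u v uv Ee => [i|j] [i'|j'] // _ Ee; [exists i, j'|exists i', j];
  by apply: val_inj; rewrite /= -/(val e) Ee // setUC.
Qed.

Lemma cell_eq i j i' j' : (cell i j == cell i' j') = (i == i') && (j == j').
Proof.
apply/eqP/andP=> [/(congr1 val)/= /eq_set2[[[->] [->]]|[]]|[/eqP-> /eqP->]] //.
Qed.

Lemma cell_adj i j i' j' :
  adj (cell i j) (cell i' j') =
  ~~ ((i == i') && (j == j')) && ((i == i') || (j == j')).
Proof.
rewrite /= /line_adj cell_eq /=; congr (_ && _).
apply/set0Pn/orP=> [[[k|k]]|[/eqP->|/eqP->]].
- by rewrite !inE !orbF => /andP[/eqP[<-] /eqP[<-]]; left.
- by rewrite !inE => /andP[/eqP[<-] /eqP[<-]]; right.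
- by exists (inl i'); rewrite !inE eqxx.
- by exists (inr j'); rewrite !inE eqxx !orbT.
Qed.

Lemma tau_line_biclique : 1 < n -> 1 < m ->
  3 <= #|line_graph biclique| /\ tau (line_graph biclique) 3 = n + m - 4.
Proof.
move=> n1 m1; have n0 : 0 < n by lia.
have m0 : 0 < m by lia.
pose i0 := Ordinal n0; pose i1 := Ordinal n1.
pose j0 := Ordinal m0; pose j1 := Ordinal m1.
(* An L with corner [cell i0 j0], which has n + m - 2 neighbours, two of them in [S]. *)
pose S := [set cell i0 j0; cell i0 j1; cell i1 j0].
have S3 : #|S| = 3 by rewrite card_set3 !inE !cell_eq.
have L3 : 3 <= #|line_graph biclique| by rewrite -S3 max_card.
split=> //; apply/eqP; rewrite eqn_leq; apply/andP; split; last first.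
  have [T /cards3_exists[x [y [z ->]]] ->] := tau_attained L3.
  have [r1 [c1 ->]] := cell_surj x; have [r2 [c2 ->]] := cell_surj y.
  have [r3 [c3 ->]] := cell_surj z.
  exact: tau_set_ge_rook cell_eq cell_adj.
apply: leq_trans (tau_min S3) _.
have sS : cell i0 j0 \in S by rewrite !inE eqxx.
apply: leq_trans (tau_set_le_neighbours _ sS) _; first by rewrite S3.
have -> : n + m - 4 = #|sum_set (~: [set i0; i1]) (~: [set j0; j1])|.
  rewrite card_sum_set (cardsCs (~: [set i0; _])) (cardsCs (~: [set j0; _])).
  by rewrite !setCK !card_ord !cards2 /=; lia.
(* The remaining neighbours of the corner lie in column [j0] or in row [i0]. *)
pose f (u : 'I_n + 'I_m) := match u with inl i => cell i j0 | inr j => cell i0 j end.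
apply: leq_trans (leq_imset_card f _).
apply/subset_leq_card/subsetP=> e; have [i [j ->]] := cell_surj e.
rewrite !inE [adj _ _]cell_adj !cell_eq ![i0 == _]eq_sym ![j0 == _]eq_sym.
case: (i =P i0) => [->|/eqP/negPf ni] H; apply/imsetP.
  exists (inr j) => //; move: H; rewrite !inE /=.
  by case: (j == j0) => //=; case: (j == j1).
case: (j =P j0) H => [->|_] H; last by move: H; rewrite /= !andbF.
exists (inl i) => //; move: H; rewrite !inE ni /=.
by case: (i == i1).
Qed.

End CompleteBipartite.

Theorem theorem4p1 (p q : nat) (hp : 1 < p) (hq : 2 * p <= q) :
  exists G : sgraph,
    [/\ 3 <= #|G|, 3 <= #|line_graph G|,
        tau G 3 = p & tau (line_graph G) 3 = q].
Proof.
(* By [2 * p <= q] the subtraction is exact and the first side is not larger than the second, as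
   [tau_biclique] requires. *)
exists (biclique p.+2 (q - p).+2).
have [||L3 tL] := @tau_line_biclique p.+2 (q - p).+2; try lia.
split=> //; first by rewrite card_sum !card_ord; lia.
  by rewrite tau_biclique; lia.
by rewrite tL; lia.
Qed.
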